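(* Let $A\in\mathbb{R}^{l\times m}$, $B\in\mathbb{R}^{n\times m}$ with $C=\ker A\cap\mathbb{R}^m_>\neq\emptyset$ and $d_P=d$, and let $v^1,\ldots,v^{n_P}$, $G$, $H$ and $F\colon\mathbb{R}^{d_P}\to\mathbb{R}^d_>$ be as defined in the context. The map $F$ is proper if and only if, for all nonzero $\xi\in\mathbb{R}^{d_P}$, there exists $i\in\{1,2,\ldots,d\}$ such that \[ \eta_i(\xi)=\sum_{j=1}^m\mu_j^{\max}(\xi)\,H_{ji}\neq0, \] where \[ \mu_j^{\max}(\xi)=\max_{k\colon v_j^k\neq0}\,G^{\mathsf T}v^k\cdot\xi,\qquad j=1,\ldots,m . \]
   Context: Notation: $\mathbb{R}_>$ are the positive reals, $\mathbb{R}_\ge$ the nonnegative reals, $1_m\in\mathbb{R}^m$ is the all-ones vector. For $x\in\mathbb{R}^m_>$ and $y\in\mathbb{R}^m$, $x^y=\prod_i x_i^{y_i}$; for a matrix $Y=(y^1,\ldots,y^r)\in\mathbb{R}^{m\times r}$ with columns $y^j$, $x^Y\in\mathbb{R}^r_>$ has components $(x^Y)_j=x^{y^j}$. Coefficient polytope: $P=C\cap\Delta$ with $C=\ker A\cap\mathbb{R}^m_>$ (assumed nonempty) and $\Delta=\{y\in\mathbb{R}^m_\ge\mid 1_m\cdot y=1\}$; $d_P=\dim P$. $P$ is relatively open; its closure $\overline P$ is a polytope with vertices $v^1,\ldots,v^{n_P}\in\mathbb{R}^m$. Subspaces: $\mathcal{A}=\begin{pmatrix}A\\1_m^{\mathsf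 T}\end{pmatrix}$, $T=\ker\mathcal{A}$ (of dimension $d_P$), $T=\operatorname{im}G$ with $G\in\mathbb{R}^{m\times d_P}$ having orthonormal columns. $\mathcal{B}=\begin{pmatrix}B\\1_m^{\mathsf T}\end{pmatrix}$, $D=\ker\mathcal{B}$, $d=\dim D$, $D=\operatorname{im}H$ with basis matrix $H\in\mathbb{R}^{m\times d}$. Standing assumption: $d_P=d$. Parametrization $p\colon\mathbb{R}^{d_P}\to P$ (a real analytic isomorphism) and map $F$: \[ p(\xi)=\frac{\sum_{k=1}^{n_P}\mathrm{e}^{v^k\cdot G\xi}\,v^k}{\sum_{k=1}^{n_P}\mathrm{e}^{v^k\cdot G\xi}},\qquad F\colon\mathbb{R}^{d_P}\to\mathbb{R}^d_>,\quad F(\xi)=p(\xi)^H . \] A map $\Psi\colon X\to Y$ is proper if $\Psi^{-1}(K)$ is compact for every compact $K\subseteq Y$. *)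

(* Defs.v *)
From HB Require Import structures.
From mathcomp Require Import all_boot all_order all_algebra.
From mathcomp Require Import all_classical all_reals all_analysis.
Import Order.TTheory GRing.Theory Num.Theory.
Import numFieldNormedType.Exports.

Set Implicit Arguments.
Unset Strict Implicit.
Unset Printing Implicit Defensive.

Local Open Scope classical_set_scope.
Local Open Scope ring_scope.

(* Vectors of R^m are column vectors 'cV[R]_m throughout. *)

Section LinearAlgebra.
Context {R : realType}.

Definition dot m (x y : 'cV[R]_m) : R := \sum_(i < m) x i 0 * y i 0.

Definition null_space m n (M : 'M[R]_(n, m)) : set 'cV[R]_m :=
  [set x | M *m x = 0].

Definition col_space m n (M : 'M[R]_(n, m)) : set 'cV[R]_n := range (mulmx M).

Definition positive_orthant m : set 'cV[R]_m :=
  [set x : 'cV[R]_m | forall i, 0 < x i 0].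

Definition augment m n (M : 'M[R]_(n, m)) : 'M[R]_(n + 1, m) :=
  col_mx M (const_mx 1).

Definition orthonormal_columns m n (M : 'M[R]_(m, n)) : Prop :=
  M^T *m M = 1%:M.

Definition basis_matrix m n (M : 'M[R]_(m, n)) (V : set 'cV[R]_m) : Prop :=
  row_free M^T /\ col_space M = V.

(* The largest k such that S contains k + 1 affinely independent points
   x, x + u_1, ..., x + u_k, the u_i being the columns of U; by convention the
   empty set has dimension 0. *)
Definition affine_dim m (S : set 'cV[R]_m) : nat :=
  \max_(k < m.+1 | `[< exists (x : 'cV[R]_m) (U : 'M[R]_(m, k)),
      [/\ row_free U^T, S x & forall i, S (x + col i U)] >]) k.

(* For a polytope S, these are its vertices. *)
Definition extreme_points m (S : set 'cV[R]_m) : set 'cV[R]_m :=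
  [set x | S x /\ forall (y z : 'cV[R]_m) (t : R), S y -> S z -> 0 < t < 1 ->
     x = t *: y + (1 - t) *: z -> y = x /\ z = x].

Definition simplex m : set 'cV[R]_m :=
  [set y : 'cV[R]_m | (forall i, 0 <= y i 0) /\ dot (const_mx 1) y = 1].

Definition vpow m (x y : 'cV[R]_m) : R := \prod_(i < m) (x i 0) `^ (y i 0).

Definition mxpow m n (x : 'cV[R]_m) (Y : 'M[R]_(m, n)) : 'cV[R]_n :=
  \col_j vpow x (col j Y).

End LinearAlgebra.

Arguments positive_orthant R m : clear implicits.
Arguments simplex R m : clear implicits.

(* Properness of f as a map X -> D, where D is a subspace of Y containing the
   values of f; a subset K of D is compact in D iff it is compact in Y. *)
Definition proper_into (X Y : topologicalType) (D : set Y) (f : X -> Y) : Prop :=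
  forall K : set Y, K `<=` D -> compact K -> compact (f @^-1` K).

Section Polytope.
Context {R : realType}.

Definition coeff_cone l m (A : 'M[R]_(l, m)) : set 'cV[R]_m :=
  null_space A `&` positive_orthant R m.

Definition coeff_polytope l m (A : 'M[R]_(l, m)) : set 'cV[R]_m :=
  coeff_cone A `&` simplex R m.

Definition vertex_family l m (A : 'M[R]_(l, m)) nP (v : 'I_nP -> 'cV[R]_m) :
    Prop :=
  injective v /\ range v = extreme_points (closure (coeff_polytope A)).

Variables (m nP dP d : nat) (v : 'I_nP -> 'cV[R]_m).
Variables (G : 'M[R]_(m, dP)) (H : 'M[R]_(m, d)).

Definition polytope_param (xi : 'cV[R]_dP) : 'cV[R]_m :=
  (\sum_(k < nP) expR (dot (v k) (G *m xi)))^-1 *: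
  \sum_(k < nP) expR (dot (v k) (G *m xi)) *: v k.

Definition Fmap (xi : 'cV[R]_dP) : 'cV[R]_d := mxpow (polytope_param xi) H.

(* The maximum is taken in \bar R, where -oo is neutral. For the vertices of
   the closed coefficient polytope, the index set is nonempty for every j (the
   polytope has points with positive j-th coordinate), so the maximum is a
   real number. *)
Definition mu_max (j : 'I_m) (xi : 'cV[R]_dP) : R :=
  fine (\big[maxe/-oo%E]_(k < nP | v k j 0 != 0) (dot (G^T *m v k) xi)%:E).

Definition eta_coef (i : 'I_d) (xi : 'cV[R]_dP) : R :=
  \sum_(j < m) mu_max j xi * H j i.

End Polytope.

(* Main.v *)
Require Import Defs.
From mathcomp Require Import all_boot all_order all_algebra.
From mathcomp Require Import all_classical all_reals all_analysis.
From mathcomp Require Import ring lra.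
Import Order.TTheory GRing.Theory Num.Theory.
Import numFieldNormedType.Exports.

Local Open Scope classical_set_scope.
Local Open Scope ring_scope.

Set Implicit Arguments.
Unset Strict Implicit.
Unset Printing Implicit Defensive.

(** The functions eta_i are the asymptotics of the coordinates of F on a
logarithmic scale, with an error that is bounded uniformly in xi.

Write e_k(xi) for v^k . G xi, and S_j(xi) for sum_k exp(e_k(xi)) v^k_j, so that
p(xi)_j = S_j(xi) / Z(xi) with the same Z for all j.  Each column of H lies in
D, hence sums to zero, and therefore Z cancels in a generalized monomial:
ln F_i(xi) = sum_j H_ji ln S_j(xi)  ([Fmap_expR]).  In S_j only the vertices
with v^k_j > 0 contribute, and a sum of exponentials with positive weights is
comparable to its largest exponential: ln S_j(xi) = mu_j^max(xi) + O(1)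
([ln_sum_expR_le]).  Summing over j, ln F_i(xi) = eta_i(xi) + O(1)
([ln_Fmap_eta_coef]).

The functions eta_i are moreover continuous and positively homogeneous of
degree one, and for such functions the growth at infinity is decided on the
unit sphere ([proper_log_asymptotic]).  If they vanish simultaneously at some
xi <> 0, they vanish on the whole ray through xi, so F maps this ray into a
compact box of the positive orthant and is not proper.  If they do not,
sum_i |eta_i(xi)| >= c |xi| for some c > 0 by compactness of the sphere, so
ln F is bounded only on bounded sets, and F is proper.

All this needs that, for every j, some vertex has a nonzero j-th coordinate, so
that the maximum mu_j^max is over a nonempty set.  Such a vertex is obtained
directly: a maximizer of |y|^2 + c y_j over the closed polytope is an extreme
point because the function is strictly convex, and its j-th coordinate is
nonzero if c is large ([extreme_point_coord_neq0]). *)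

Section MonomialMap.
Context {R : realType}.

(** * Topology of matrix spaces *)

Lemma continuous_mx (T : topologicalType) p q (f : T -> 'M[R]_(p, q)) :
  (forall i j, continuous (fun x => f x i j)) -> continuous f.
Proof.
move=> cf x A [B fB sBA].
have : \forall y \near x, forall i j, B i j (f y i j).
  apply: filter_forall => i; apply: filter_forall => j.
  exact: (cf i j x _ (fB i j)).
by apply: filterS => y By; apply: sBA.
Qed.

Lemma norm_entry_le p q (M : 'M[R]_(p, q)) i j : `|M i j| <= `|M|.
Proof.
rewrite [leRHS]/Num.norm /= mx_normrE.
exact: (le_bigmax _ (fun ij => `|M ij.1 ij.2|) (i, j)).
Qed.

Lemma mx_norm_le p q (M : 'M[R]_(p, q)) c :
  0 <= c -> (forall i j, `|M i j| <= c) -> `|M| <= c.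
Proof.
move=> c0 Mc; rewrite [leLHS]/Num.norm /= mx_normrE.
by apply: bigmax_le => // -[i j] _; exact: Mc.
Qed.

(** Heine-Borel for column vectors, by transposition from row vectors. *)
Lemma cV_bounded_closed_compact n (A : set 'cV[R]_n) M :
  (forall x, A x -> `|x| <= M) -> closed A -> compact A.
Proof.
move=> bA cA.
have ctr p q : continuous (fun x : 'M[R]_(p, q) => x^T).
  apply: continuous_mx => i j.
  rewrite (_ : (fun _ => _) = fun x : 'M[R]_(p, q) => x j i); last first.
    by apply/funext => x; rewrite mxE.
  exact: coord_continuous.
have -> : A = trmx @` ((fun x : 'rV[R]_n => x^T) @^-1` A).
  apply/seteqP; split => [x Ax|_ [x Ax <-]//].
  by exists x^T; rewrite /= trmxK.
apply: continuous_compact; first exact/continuous_subspaceT/ctr.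
apply: bounded_closed_compact; last first.
  by have /continuous_closedP := ctr 1 n; exact.
exists M; split; first exact: num_real.
move=> N MN x /= /bA xM; apply/(le_trans _ (ltW MN))/(le_trans _ xM).
by apply: mx_norm_le => // i j; have := norm_entry_le x^T j i; rewrite mxE.
Qed.

Lemma continuous_sumr (T : topologicalType) (I : Type) (r : seq I) (P : pred I)
    (f : I -> T -> R) :
  (forall i, P i -> continuous (f i)) ->
  continuous (fun x => \sum_(i <- r | P i) f i x).
Proof. by apply: continuous_big; exact: add_continuous. Qed.

Lemma dotZr m (x y : 'cV[R]_m) t : dot x (t *: y) = t * dot x y.
Proof.
by rewrite /dot mulr_sumr; apply: eq_bigr => i _; rewrite mxE mulrCA.
Qed.

Lemma dot1E m (y : 'cV[R]_m) : dot (const_mx 1) y = \sum_i y i 0.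
Proof. by apply: eq_bigr => i _; rewrite mxE mul1r. Qed.

Lemma dot_ge0 m (y : 'cV[R]_m) : 0 <= dot y y.
Proof. by apply: sumr_ge0 => i _; rewrite -expr2 sqr_ge0. Qed.

Lemma dot_eq0 m (y : 'cV[R]_m) : dot y y = 0 -> y = 0.
Proof.
move=> /eqP; rewrite psumr_eq0 => [/allP y0|i _]; last by rewrite -expr2 sqr_ge0.
apply/matrixP => i j; rewrite (ord1 j) mxE.
by have := y0 i (mem_index_enum _); rewrite -expr2 sqrf_eq0 => /eqP.
Qed.

Lemma dot_trmx_mul m n (G : 'M[R]_(m, n)) x y :
  dot (G^T *m x) y = dot x (G *m y).
Proof.
rewrite /dot; under eq_bigr do rewrite mxE mulr_suml.
rewrite exchange_big; apply: eq_bigr => j _ /=.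
rewrite [in RHS]mxE mulr_sumr; apply: eq_bigr => i _.
by rewrite mxE -mulrA mulrCA.
Qed.

Lemma dot_continuous m (T : topologicalType) (f g : T -> 'cV[R]_m) :
  continuous f -> continuous g -> continuous (fun x => dot (f x) (g x)).
Proof.
move=> cf cg; apply: continuous_sumr => i _ x; apply: continuousM.
- apply: (@continuous_comp _ _ _ f (fun y : 'cV[R]_m => y i 0)).
    exact: cf.
  exact: coord_continuous.
- apply: (@continuous_comp _ _ _ g (fun y : 'cV[R]_m => y i 0)).
    exact: cg.
  exact: coord_continuous.
Qed.

(** * Properness and logarithmic asymptotics *)

(** The minimum of f on the unit sphere serves as c. *)
Lemma coercive_of_homogeneous n (f : 'cV[R]_n -> R) :
  continuous f -> (forall t x, 0 <= t -> f (t *: x) = t * f x) ->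
  (forall x, x != 0 -> 0 < f x) ->
  exists2 c, 0 < c & forall x, c * `|x| <= f x.
Proof.
move=> cf fZ f_gt0.
have f0 : f 0 = 0 by rewrite -(scale0r 0) fZ // mul0r.
pose S := [set x : 'cV[R]_n | `|x| = 1].
have normS (x : 'cV[R]_n) : x != 0 -> S (`|x|^-1 *: x).
  move=> x0; rewrite /S /= normrZ ger0_norm ?invr_ge0 //.
  by rewrite mulVf // normr_eq0.
(* The sphere is empty exactly when n = 0. *)
have [S0|S0] := pselect (S !=set0); last first.
  exists 1 => // x; have [->|x0] := eqVneq x 0; first by rewrite normr0 mulr0 f0.
  by case: S0; exists (`|x|^-1 *: x); exact: normS.
have cS : compact S.
  apply: (@cV_bounded_closed_compact _ _ 1) => [x -> //|].
  have /continuous_closedP h := @norm_continuous R 'cV[R]_n.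
  exact: (h _ (@closed_eq R 1)).
have [c cinS cmin] := compact_EVT_min S0 cS (continuous_subspaceT cf).
exists (f c).
  apply: f_gt0; rewrite -normr_eq0.
  by have := set_mem cinS; rewrite /S /= => ->; rewrite oner_eq0.
move=> x; have [->|x0] := eqVneq x 0; first by rewrite normr0 mulr0 f0.
have nx : 0 < `|x| by rewrite normr_gt0.
rewrite -ler_pdivlMr // mulrC -fZ ?invr_ge0 //.
by apply: cmin; rewrite inE; exact: normS.
Qed.

(** A common zero x of the eta_i gives a ray on which ln F is bounded; without
one, ln F is bounded only where the coercive function sum_i |eta_i| is, that is
on bounded sets.  The logarithm matters because a compact subset of the open
orthant keeps away from its boundary: this is what bounds ln on it. *)
Lemma proper_log_asymptotic n d (F : 'cV[R]_n -> 'cV[R]_d)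
    (eta : 'I_d -> 'cV[R]_n -> R) :
  continuous F -> (forall x i, 0 < F x i 0) ->
  (forall i, continuous (eta i)) ->
  (forall i t x, 0 <= t -> eta i (t *: x) = t * eta i x) ->
  (forall i, exists M, forall x, `|ln (F x i 0) - eta i x| <= M) ->
  proper_into (positive_orthant R d) F <->
  (forall x, x != 0 -> exists i, eta i x != 0).
Proof.
move=> cF F_gt0 ceta etaZ /choice[M FM].
split => [Fproper x x0|eta_neq0 K Kpos cK].
  apply: contrapT => /forallNP eta0.
  pose K := [set y : 'cV[R]_d | forall i, expR (- M i) <= y i 0 <= expR (M i)].
  have Kcompact : compact K.
    apply: (@cV_bounded_closed_compact _ _ (\sum_i expR (M i))) => [y Ky|].
      apply: mx_norm_le => [|i j]; first by apply: sumr_ge0 => i _; exact: expR_ge0.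
      have /andP[yl yu] := Ky i.
      rewrite (ord1 j) ger0_norm ?(le_trans _ yl) ?expR_ge0 //.
      rewrite (le_trans yu) // (bigD1 i) //= lerDl.
      by apply: sumr_ge0 => k _; exact: expR_ge0.
    have -> : K = \bigcap_i ((fun y : 'cV[R]_d => y i 0) @^-1`
        `[expR (- M i), expR (M i)]).
      apply/seteqP; split => y Ky i; first by move=> _ /=; rewrite in_itv /= Ky.
      by have := Ky i Logic.I; rewrite /= in_itv.
    apply: closed_bigI => i _.
    have /continuous_closedP := @coord_continuous R d 1 i 0; apply.
    exact: itv_closed.
  have ray t : 0 <= t -> (F @^-1` K) (t *: x).
    move=> t0 i; have := FM i (t *: x).
    rewrite etaZ //; have /negP := eta0 i; rewrite negbK => /eqP ->.
    rewrite mulr0 subr0 ler_norml => /andP[l u].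
    by rewrite -[F _ i 0]lnK ?posrE ?F_gt0 // !ler_expR l u.
  have [|N [_ /(_ (N + 1))]] := compact_bounded (Fproper K _ Kcompact).
    by move=> y Ky i; apply: lt_le_trans (andP (Ky i)).1; exact: expR_gt0.
  rewrite ltrDl ltr01 => /(_ isT) Nbound.
  have nx : 0 < `|x| by rewrite normr_gt0.
  (* The point of the ray at distance |N| + 2 from the origin violates the bound
     N + 1 on the preimage of K. *)
  have N2 : 0 <= `|N| + 2 by rewrite addr_ge0.
  have := Nbound _ (ray _ (divr_ge0 N2 (ltW nx))).
  rewrite /= normrZ normrM normfV normr_id divfK ?gt_eqF // ger0_norm //.
  have := ler_norm N; lra.
have [c c_gt0 cle] : exists2 c, 0 < c &
    forall x, c * `|x| <= \sum_i `|eta i x|.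
  apply: (@coercive_of_homogeneous _ (fun x => \sum_i `|eta i x|)).
  - apply: continuous_sumr => i _ x.
    exact: (continuous_comp (ceta i x) (@norm_continuous _ _ _)).
  - move=> t x t0; rewrite mulr_sumr; apply: eq_bigr => i _.
    by rewrite etaZ // normrM ger0_norm.
  - move=> x /eta_neq0[i etai]; rewrite (bigD1 i) //= ltr_pwDl ?normr_gt0 //.
    exact: sumr_ge0.
have KN i : exists N, forall y, K y -> `|ln (y i 0)| <= N.
  have : compact ((fun y : 'cV[R]_d => ln (y i 0)) @` K).
    apply: continuous_compact => //.
    apply: continuous_in_subspaceT => y /set_mem /Kpos yi.
    apply: (@continuous_comp 'cV[R]_d R R (fun z => z i 0) (@ln R) y).
      exact: coord_continuous.
    exact/continuous_ln/yi.
  move=> /compact_bounded[N [_ HN]]; exists (N + 1) => y Ky.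
  by apply: HN; [rewrite ltrDl | exists y].
have {KN} [N KN] := choice KN.
apply: (@cV_bounded_closed_compact _ _ (c^-1 * \sum_i (M i + N i))); last first.
  have /continuous_closedP := cF; apply.
  by apply: compact_closed => //; exact: norm_hausdorff.
move=> x Kx; rewrite mulrC ler_pdivlMr // mulrC.
apply: (le_trans (cle x)); apply: ler_sum => i _.
have := FM i x; have := KN i _ Kx; rewrite !ler_norml => /andP[? ?] /andP[? ?].
apply/andP; split; lra.
Qed.

(** The sum lies between its dominant term, of weight w k0, and
exp(f k0) * sum_k w k.  The weight w k0 varies with f, so its logarithm is
absorbed in a sum over all k to keep M independent of f. *)
Lemma ln_sum_expR_le (I : finType) (w : I -> R) :
  (forall k, 0 <= w k) ->
  exists M, forall (f : I -> R) k0, w k0 != 0 ->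
    (forall k, w k != 0 -> f k <= f k0) ->
    `|ln (\sum_k expR (f k) * w k) - f k0| <= M.
Proof.
move=> w_ge0; exists (\sum_k `|ln (w k)| + `|ln (\sum_k w k)|) => f k0 wk0 fmax.
have wk0_gt0 : 0 < w k0 by rewrite lt_neqAle eq_sym wk0 w_ge0.
have lb : expR (f k0) * w k0 <= \sum_k expR (f k) * w k.
  rewrite [leRHS](bigD1 k0) //= lerDl.
  by apply: sumr_ge0 => k _; rewrite mulr_ge0 ?expR_ge0.
have ub : \sum_k expR (f k) * w k <= expR (f k0) * \sum_k w k.
  rewrite mulr_sumr; apply: ler_sum => k _.
  have [->|/fmax] := eqVneq (w k) 0; first by rewrite !mulr0.
  by move=> fk; rewrite ler_wpM2r // ler_expR.
have lb_gt0 : 0 < expR (f k0) * w k0 by rewrite mulr_gt0 ?expR_gt0.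
have S_gt0 := lt_le_trans lb_gt0 lb.
have W_gt0 : 0 < \sum_k w k.
  by have := lt_le_trans S_gt0 ub; rewrite pmulr_rgt0 ?expR_gt0.
move: lb; rewrite -ler_ln ?posrE // lnM ?posrE ?expR_gt0 // expRK => lb.
move: ub; rewrite -ler_ln ?posrE ?mulr_gt0 ?expR_gt0 //.
rewrite lnM ?posrE ?expR_gt0 // expRK => ub.
have wk0_le : `|ln (w k0)| <= \sum_k `|ln (w k)|.
  by rewrite [leRHS](bigD1 k0) //= lerDl sumr_ge0.
have h2 := ler_norm (ln (\sum_k w k)); have h1 := ler_norm (- ln (w k0)).
rewrite normrN in h1; rewrite ler_norml.
have := normr_ge0 (ln (\sum_k w k)); have := normr_ge0 (ln (w k0)).
move=> ? ?; apply/andP; split; lra.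
Qed.

(** * The parametrization and its monomial image *)

Section Parametrization.
Context {m nP dP d : nat} (v : 'I_nP -> 'cV[R]_m).
Context (G : 'M[R]_(m, dP)) (H : 'M[R]_(m, d)).
Context (v_ge0 : forall k j, 0 <= v k j 0).
Context (v_supp : forall j, exists k, v k j 0 != 0).

Definition exponent k (xi : 'cV[R]_dP) := dot (v k) (G *m xi).

Lemma exponent_continuous k : continuous (exponent k).
Proof.
rewrite (_ : exponent k = fun xi => dot (G^T *m v k) xi); last first.
  by apply/funext => xi; rewrite dot_trmx_mul.
by apply: dot_continuous => xi; [exact: cst_continuous|exact: cvg_id].
Qed.

Lemma exponentZ k t xi : exponent k (t *: xi) = t * exponent k xi.
Proof. by rewrite /exponent -scalemxAr dotZr. Qed.

(** Replaces the maximum taken in the extended reals, and its default value, by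
an exponent at which it is attained. *)
Lemma mu_maxP j xi : exists k0,
  [/\ v k0 j 0 != 0, mu_max v G j xi = exponent k0 xi &
      forall k, v k j 0 != 0 -> exponent k xi <= exponent k0 xi].
Proof.
have [k1 k1j] := v_supp j.
have [k0 k0j k0max] :=
  @arg_maxP _ _ _ k1 (fun k => v k j 0 != 0) (exponent^~ xi) k1j.
exists k0; split => //; rewrite /mu_max.
rewrite (_ : \big[_/_]_(k < nP | _) _ = (exponent k0 xi)%:E) //.
apply/le_anti/andP; split.
  apply: bigmax_le => [|k kj]; first exact: leNye.
  by rewrite dot_trmx_mul lee_fin; exact: k0max.
by apply: (bigmax_sup k0) => //; rewrite dot_trmx_mul.
Qed.

Lemma mu_maxZ j t xi : 0 <= t -> mu_max v G j (t *: xi) = t * mu_max v G j xi.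
Proof.
move=> t0; have [k [kj -> kmax]] := mu_maxP j xi.
have [l [lj -> lmax]] := mu_maxP j (t *: xi).
apply/le_anti/andP; split; first by rewrite exponentZ ler_wpM2l ?kmax.
by rewrite -exponentZ lmax.
Qed.

(** A maximum of finitely many functions moves by no more than the functions do
in total. *)
Lemma mu_max_continuous j : continuous (mu_max v G j).
Proof.
move=> xi.
have lip zeta : `|mu_max v G j xi - mu_max v G j zeta| <=
    \sum_k `|exponent k xi - exponent k zeta|.
  have [k [kj -> kmax]] := mu_maxP j xi.
  have [l [lj -> lmax]] := mu_maxP j zeta.
  have term i : `|exponent i xi - exponent i zeta| <=
      \sum_k `|exponent k xi - exponent k zeta|.
    by rewrite [leRHS](bigD1 i) //= lerDl sumr_ge0.
  have := term k; have := term l; have := lmax k kj; have := kmax l lj.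
  rewrite !ler_norml => h1 h2 /andP[? ?] /andP[? ?]; apply/andP; split; lra.
have csum : continuous (fun zeta => \sum_k `|exponent k xi - exponent k zeta|).
  apply: continuous_sumr => k _ zeta.
  apply: (@continuous_comp _ _ _ (fun z => exponent k xi - exponent k z)
    (@Num.norm _ R)); last exact: norm_continuous.
  by apply: continuousB; [exact: cst_continuous|exact: exponent_continuous].
apply/(@cvgrPdist_le _ _ _ _ (nbhs_filter xi)) => e e0.
have := csum xi; rewrite /continuous_at.
rewrite [X in _ --> X]big1 => [|k _]; last by rewrite subrr normr0.
move=> /(@cvgrPdist_le _ _ _ _ (nbhs_filter xi)) /(_ e e0).
apply: filterS => zeta; rewrite sub0r normrN => h.
by rewrite (le_trans (lip zeta)) // (le_trans (ler_norm _)).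
Qed.

Definition numerator j xi := \sum_k expR (exponent k xi) * v k j 0.

Lemma numerator_gt0 j xi : 0 < numerator j xi.
Proof.
have [k kj] := v_supp j.
rewrite /numerator (bigD1 k) //= ltr_pwDl //.
  by rewrite mulr_gt0 ?expR_gt0 // lt_neqAle eq_sym kj v_ge0.
by apply: sumr_ge0 => l _; rewrite mulr_ge0 ?expR_ge0.
Qed.

Lemma numerator_continuous j : continuous (numerator j).
Proof.
apply: continuous_sumr => k _ xi.
apply: (@continuousM _ _ (fun x => expR (exponent k x)) (fun=> v k j 0)).
  apply: (@continuous_comp _ _ _ (exponent k) (@expR R)).
    exact: exponent_continuous.
  exact: continuous_expR.
exact: cst_continuous.
Qed.

Lemma ln_numerator_mu_max j :
  exists M, forall xi, `|ln (numerator j xi) - mu_max v G j xi| <= M.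
Proof.
have [M HM] := ln_sum_expR_le (fun k => v_ge0 k j).
exists M => xi; have [k [kj -> kmax]] := mu_maxP j xi.
exact: (HM (exponent^~ xi)).
Qed.

Context (H_sum0 : forall i, \sum_j H j i = 0).

(** The common denominator Z of the coordinates of p enters with exponent
- sum_j H j i = 0. *)
Lemma Fmap_expR xi i :
  Fmap v G H xi i 0 = expR (\sum_j H j i * ln (numerator j xi)).
Proof.
rewrite /Fmap /mxpow mxE /vpow.
pose Z := \sum_(k < nP) expR (exponent k xi).
have term j : polytope_param v G xi j 0 `^ col i H j 0 =
    expR (H j i * ln (numerator j xi) - H j i * ln Z).
  (* Z is positive only because there is a vertex, which is known once there is
     a coordinate j. *)
  have [k kj] := v_supp j.
  have Z_gt0 : 0 < Z.
    rewrite /Z (bigD1 k) //= ltr_pwDl ?expR_gt0 //.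
    by apply: sumr_ge0 => l _; exact: expR_ge0.
  have -> : polytope_param v G xi j 0 = Z^-1 * numerator j xi.
    rewrite /polytope_param mxE summxE; congr (_ * _).
    by apply: eq_bigr => l _; rewrite mxE.
  rewrite /powR gt_eqF; last by rewrite mulr_gt0 ?invr_gt0 ?numerator_gt0.
  rewrite lnM ?posrE ?invr_gt0 ?numerator_gt0 // lnV ?posrE //.
  by rewrite mxE -mulrBr addrC.
rewrite (eq_bigr _ (fun j _ => term j)) -expR_sum; congr expR.
by rewrite big_split /= sumrN -mulr_suml H_sum0 mul0r subr0.
Qed.

Lemma Fmap_gt0 xi i : 0 < Fmap v G H xi i 0.
Proof. by rewrite Fmap_expR expR_gt0. Qed.

Lemma Fmap_continuous : continuous (Fmap v G H).
Proof.
apply: continuous_mx => i j; rewrite (ord1 j).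
under eq_fun do rewrite Fmap_expR.
move=> xi; apply: (@continuous_comp _ _ _
  (fun xi => \sum_j H j i * ln (numerator j xi)) (@expR R)); last first.
  exact: continuous_expR.
apply: continuous_sumr => {}j _ {}xi.
apply: (@continuousM _ _ (fun=> H j i) (fun x => ln (numerator j x))).
  exact: cst_continuous.
apply: (@continuous_comp _ _ _ (numerator j) (@ln R)).
  exact: numerator_continuous.
exact/continuous_ln/numerator_gt0.
Qed.

Lemma ln_Fmap_eta_coef i :
  exists M, forall xi, `|ln (Fmap v G H xi i 0) - eta_coef v G H i xi| <= M.
Proof.
have [M HM] := choice ln_numerator_mu_max.
exists (\sum_j `|H j i| * M j) => xi.
rewrite Fmap_expR expRK /eta_coef -sumrB (le_trans (ler_norm_sum _ _ _)) //.
apply: ler_sum => j _; rewrite [mu_max _ _ _ _ * _]mulrC -mulrBr normrM.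
by rewrite ler_wpM2l.
Qed.

Lemma Fmap_proper_iff : proper_into (positive_orthant R d) (Fmap v G H) <->
  (forall xi, xi != 0 -> exists i, eta_coef v G H i xi != 0).
Proof.
apply: (proper_log_asymptotic Fmap_continuous Fmap_gt0) => [i|i t xi t0|i].
- apply: continuous_sumr => j _ xi.
  apply: (@continuousM _ _ (mu_max v G j) (fun=> H j i)).
    exact: mu_max_continuous.
  exact: cst_continuous.
- rewrite mulr_sumr; apply: eq_bigr => j _.
  by rewrite mu_maxZ // mulrA.
- exact: ln_Fmap_eta_coef.
Qed.

End Parametrization.

(** * Extreme points with a nonzero coordinate *)

Lemma simplex_closed m : closed (simplex R m).
Proof.
have -> : simplex R m =
    (\bigcap_i ((fun y : 'cV[R]_m => y i 0) @^-1` [set x | 0 <= x])) `&`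
    (dot (const_mx 1) @^-1` [set x | x = 1]).
  apply/seteqP; split => y [y0 y1]; split => // i.
    by move=> _; exact: y0.
  exact: (y0 i Logic.I).
apply: closedI.
  apply: closed_bigI => i _.
  by have /continuous_closedP := @coord_continuous R m 1 i 0; apply; exact: closed_ge.
have /continuous_closedP h : continuous (dot (const_mx 1 : 'cV[R]_m)).
  by apply: dot_continuous => y; [exact: cst_continuous|exact: cvg_id].
exact: (h _ (@closed_eq R 1)).
Qed.

Lemma simplex_le1 m (y : 'cV[R]_m) i : simplex R m y -> y i 0 <= 1.
Proof.
move=> [y0]; rewrite dot1E => <-.
by rewrite [leRHS](bigD1 i) //= lerDl sumr_ge0.
Qed.

Lemma simplex_dot_le1 m (y : 'cV[R]_m) : simplex R m y -> dot y y <= 1.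
Proof.
move=> yS; have [y0 y1] := yS; rewrite -[leRHS]y1 dot1E.
apply: ler_sum => i _; rewrite -[leRHS]mulr1.
by rewrite ler_wpM2l ?simplex_le1.
Qed.

Lemma simplex_compact m : compact (simplex R m).
Proof.
apply: (@cV_bounded_closed_compact _ _ 1); last exact: simplex_closed.
move=> y yS; apply: mx_norm_le => // i j.
by rewrite (ord1 j) ger0_norm ?simplex_le1 //; exact: yS.1.
Qed.

(** Strict convexity of f(z) = |z|^2 + c.z in quantitative form:
f(t a + (1 - t) b) = t f(a) + (1 - t) f(b) - t (1 - t) |a - b|^2. *)
Lemma maximizer_extreme m (K : set 'cV[R]_m) c y :
  K y -> (forall z, K z -> dot z z + dot c z <= dot y y + dot c y) ->
  extreme_points K y.
Proof.
move=> Ky ymax; split=> // a b t Ka Kb /andP[t0 t1] yE.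
have id : dot y y + dot c y = t * (dot a a + dot c a)
    + (1 - t) * (dot b b + dot c b) - t * (1 - t) * dot (a - b) (a - b).
  rewrite yE /dot !mulrDr !mulr_sumr -!big_split /= -sumrB.
  by apply: eq_bigr => i _; rewrite !mxE; ring.
have ha := ymax a Ka; have hb := ymax b Kb.
have ab0 : dot (a - b) (a - b) <= 0.
  rewrite -(pmulr_rle0 _ (mulr_gt0 t0 (_ : 0 < 1 - t))) ?subr_gt0 //.
  have := ler_wpM2l (ltW t0) ha.
  have : (1 - t) * (dot b b + dot c b) <= (1 - t) * (dot y y + dot c y).
    by rewrite ler_wpM2l // subr_ge0 ltW.
  by move: id; lra.
have /eqP : a - b = 0 by apply: dot_eq0; apply/le_anti; rewrite ab0 dot_ge0.
rewrite subr_eq0 => /eqP ab; move: yE.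
by rewrite ab -scalerDl addrC subrK scale1r.
Qed.

(** Since |y| <= 1 on the simplex, a linear term that is 2 at y0 makes every
point with vanishing j-th coordinate lose against y0. *)
Lemma extreme_point_coord_neq0 m (K : set 'cV[R]_m) j y0 :
  compact K -> K `<=` simplex R m -> K y0 -> 0 < y0 j 0 ->
  exists2 y, extreme_points K y & y j 0 != 0.
Proof.
move=> cK KS Ky0 y0j.
pose c : 'cV[R]_m := \col_i ((i == j)%:R * (2 / y0 j 0)).
have dotc z : dot c z = 2 / y0 j 0 * z j 0.
  rewrite /dot (bigD1 j) //= mxE eqxx mul1r big1 ?addr0 // => i /negPf ij.
  by rewrite mxE ij !mul0r.
have cf : continuous (fun z => dot z z + dot c z).
  move=> z; apply: (@continuousD _ _ _ (fun x => dot x x) (dot c)).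
    by apply: dot_continuous => x; exact: cvg_id.
  by apply: dot_continuous => x; [exact: cst_continuous|exact: cvg_id].
have [y /set_mem Ky ymax] :=
  compact_EVT_max (ex_intro _ _ Ky0) cK (continuous_subspaceT cf).
exists y.
  by apply: (@maximizer_extreme _ _ c) => // z Kz; apply: ymax; exact: mem_set.
apply/negP => /eqP yj0.
have := ymax _ (mem_set Ky0); rewrite !dotc yj0 mulr0 addr0 divfK ?gt_eqF //.
have := simplex_dot_le1 (KS _ Ky); have := dot_ge0 y0; lra.
Qed.

(** * The coefficient polytope *)

Lemma closure_coeff_polytope_subset l m (A : 'M[R]_(l, m)) :
  closure (coeff_polytope A) `<=` simplex R m.
Proof.
rewrite [X in _ `<=` X](closure_id _).1; last exact: simplex_closed.
by apply: closureS => y [].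
Qed.

(** Normalizing a point of the cone gives a point of the polytope with all
coordinates positive; this needs a coordinate j, since for m = 0 the polytope is
empty. *)
Lemma vertex_coord_neq0 l m nP (A : 'M[R]_(l, m)) (v : 'I_nP -> 'cV[R]_m) :
  coeff_cone A !=set0 -> vertex_family A v ->
  forall j, exists k, v k j 0 != 0.
Proof.
move=> [x [Ax x_gt0]] [_ v_extreme] j.
have s_gt0 : 0 < \sum_i x i 0.
  rewrite (bigD1 j) //= ltr_pwDl ?x_gt0 //.
  by apply: sumr_ge0 => i _; exact/ltW/x_gt0.
pose y := (\sum_i x i 0)^-1 *: x.
have y_gt0 i : 0 < y i 0 by rewrite mxE mulr_gt0 ?invr_gt0 ?x_gt0.
have Py : coeff_polytope A y.
  split; split=> //.
  - by rewrite /null_space /= -scalemxAr Ax scaler0.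
  - by move=> i; exact: ltW.
  - by rewrite dotZr dot1E mulVf ?gt_eqF.
have KS := @closure_coeff_polytope_subset _ _ A.
have cK := subclosed_compact (@closed_closure _ _) (@simplex_compact m) KS.
have [z] := extreme_point_coord_neq0 cK KS (@subset_closure _ _ _ Py) (y_gt0 j).
by rewrite -v_extreme => -[k _ <-]; exists k.
Qed.

Lemma augment_column_sum0 n m d (B : 'M[R]_(n, m)) (H : 'M[R]_(m, d)) i :
  col_space H `<=` null_space (augment B) -> \sum_j H j i = 0.
Proof.
move=> /(_ (H *m delta_mx i 0)) HB.
have := HB (ex_intro2 _ _ (delta_mx i 0) Logic.I erefl).
rewrite /null_space /= mul_col_mx -colE => /(congr1 dsubmx).
rewrite col_mxKd => /matrixP /(_ 0 0); rewrite !mxE => h; rewrite -[RHS]h.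
by apply: eq_bigr => j _; rewrite !mxE mul1r.
Qed.

End MonomialMap.

Theorem theorem15 (R : realType) (l n m nP dP d : nat)
  (A : 'M[R]_(l, m)) (B : 'M[R]_(n, m))
  (v : 'I_nP -> 'cV[R]_m) (G : 'M[R]_(m, dP)) (H : 'M[R]_(m, d))
  (C_nonempty : coeff_cone A !=set0)
  (v_vertices : vertex_family A v)
  (dP_def : dP = affine_dim (coeff_polytope A))
  (d_def : d = \rank (cokermx (augment B)))
  (dP_eq_d : dP = d)
  (G_orthonormal : orthonormal_columns G)
  (G_image : col_space G = null_space (augment A))
  (H_basis : basis_matrix H (null_space (augment B))) :
  proper_into (positive_orthant R d) (Fmap v G H) <->
  (forall xi : 'cV[R]_dP, xi != 0 -> exists i : 'I_d, eta_coef v G H i xi != 0).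
Proof.
apply: Fmap_proper_iff => [k|j|i].
- have : extreme_points (closure (coeff_polytope A)) (v k).
    by rewrite -v_vertices.2; exists k.
  by move=> [/closure_coeff_polytope_subset[]].
- exact: vertex_coord_neq0 C_nonempty v_vertices j.
- by apply: (@augment_column_sum0 _ _ _ _ B); rewrite H_basis.2.
Qed.
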